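(* Let $R$ be a ring and $M$ an $R$-module. If $(F,P)$ is a distributive poset filtration of $M$, then every almost gradation of $F$ is independent.
   Context: A poset filtration $(F,P)$ of an $R$-module $M$ is a partially ordered set $(P,\le)$ with an order-preserving function $F:P\to\mathrm{Sub}(M)$, $p\mapsto F_p$, to the poset of submodules of $M$. Write $F_{<p}=\sum_{q<p}F_q$. The filtration is distributive if for all finite subsets $Q\subseteq P$ and all $p\in Q$ that are maximal in $Q$, $F_p\cap\sum_{q\in Q\smallsetminus\{p\}}F_q\subseteq F_{<p}$. An almost gradation of $F$ is a function $C:P\to\mathrm{Sub}(M)$, $p\mapsto C_p$, such that $F_p=F_{<p}\oplus C_p$ for all $p\in P$. It is independent if whenever $Q\subseteq P$ is finite, $c_q\in C_q$ for $q\in Q$, and $\sum_{q\in Q}c_q=0$, then $c_q=0$ for all $q\in Q$. *)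

(* Defs.v *)
From HB Require Import structures.
From mathcomp Require Import all_boot all_order all_algebra.
From mathcomp Require Import finmap boolp.

Set Implicit Arguments.
Unset Strict Implicit.
Unset Printing Implicit Defensive.

Import Order.TTheory GRing.Theory.

Local Open Scope ring_scope.

(* Submodules of [M] are represented by [submodClosed M], whose elements are
   boolean predicates; classically this is no restriction, since [boolp] turns
   any proposition [A] into the boolean [`[< A >]]. *)

Section Submodules.
Context (R : pzRingType) (M : lmodType R).

Section Sum.
Context (I : choiceType).
Implicit Types (F : I -> submodClosed M) (J : {pred I}).

(* The set of finite sums of elements of the [F i], [i \in J]; [J] may be
   infinite, and the sum is the zero submodule when [J] is empty. *)
Definition sumsub F J : {pred M} := fun x =>
  `[< exists (Q : {fset I}) (m : I -> M),
        [/\ {subset Q <= J}, {in Q, forall i, m i \in F i}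
          & x = \sum_(i <- Q) m i] >].

Lemma sumsubP F J x :
  reflect (exists (Q : {fset I}) (m : I -> M),
    [/\ {subset Q <= J}, {in Q, forall i, m i \in F i}
      & x = \sum_(i <- Q) m i]) (x \in sumsub F J).
Proof. exact: asboolP. Qed.

Let extend0 (m : I -> M) (Q Q' : {fset I}) :
  {subset Q <= Q'} ->
  \sum_(i <- Q) m i = \sum_(i <- Q') (if i \in Q then m i else 0).
Proof.
move=> /fsubsetP QQ'; rewrite -(big_fset_incl _ QQ') => [|i _ /negbTE -> //].
by apply: eq_big_seq => i ->.
Qed.

Lemma sumsub_submod_closed F J : submod_closed (sumsub F J).
Proof.
split=> [|a x y /sumsubP[Q [m [QJ mF ->]]] /sumsubP[Q' [m' [QJ' mF' ->]]]].
  by apply/sumsubP; exists fset0, (fun=> 0); rewrite big_seq_fset0.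
apply/sumsubP; exists (Q `|` Q')%fset, (fun i =>
  a *: (if i \in Q then m i else 0) + (if i \in Q' then m' i else 0)).
split=> [i|i _|].
- by rewrite inE => /orP[/QJ|/QJ'].
- apply: rpredD; first by apply: rpredZ; case: ifP => [/mF|_] //; exact: rpred0.
  by case: ifP => [/mF'|_] //; exact: rpred0.
rewrite big_split -scaler_sumr (@extend0 m Q (Q `|` Q')%fset).
  by rewrite (@extend0 m' Q' (Q `|` Q')%fset) // => i; rewrite inE orbC => ->.
by move=> i; rewrite inE => ->.
Qed.

HB.instance Definition _ F J :=
  GRing.isSubmodClosed.Build R M (sumsub F J) (sumsub_submod_closed F J).

End Sum.

(* [N] is the internal direct sum of [A] and [B]. *)
Definition is_direct_sum (N A B : submodClosed M) : Prop :=
  (forall x, x \in N <-> exists a b, [/\ a \in A, b \in B & x = a + b])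
  /\ (forall x, x \in A -> x \in B -> x = 0).

End Submodules.

Section PosetFiltrations.
Context (R : pzRingType) (M : lmodType R).
Context (d : Order.disp_t) (P : porderType d).
Implicit Types (F C : P -> submodClosed M).

Definition poset_filtration F : Prop :=
  forall p q : P, (p <= q)%O -> {subset F p <= F q}.

Definition filt_lt F (p : P) : submodClosed M :=
  sumsub F [pred q | (q < p)%O].

Definition distributive_filtration F : Prop :=
  forall (Q : {fset P}) (p : P),
    p \in Q -> (forall q, q \in Q -> ~~ (p < q)%O) ->
  forall x, x \in F p -> x \in sumsub F [in (Q `\ p)%fset] -> x \in filt_lt F p.

Definition almost_gradation F C : Prop :=
  forall p : P, is_direct_sum (F p) (filt_lt F p) (C p).

Definition independent C : Prop :=
  forall (Q : {fset P}) (c : P -> M),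
    {in Q, forall q, c q \in C q} -> \sum_(q <- Q) c q = 0 ->
  {in Q, forall q, c q = 0}.

End PosetFiltrations.

(* Main.v *)
Require Import Defs.
From mathcomp Require Import all_boot all_order all_algebra.
From mathcomp Require Import finmap.

Set Implicit Arguments.
Unset Strict Implicit.
Unset Printing Implicit Defensive.

Import Order.TTheory GRing.Theory.

Local Open Scope ring_scope.

(** In a relation [\sum_(q <- Q) c q = 0] with [c q \in C q], take [p] maximal
    in the finite set [Q].  The relation expresses [c p] through the other
    terms, which lie in the [F q], [q \in Q], [q != p]; distributivity then puts
    [c p] in [F_{<p}], which meets [C p] only in [0] (lemma [maximal_term_eq0]).
    So [c p] vanishes and may be deleted from the relation, and induction on the
    number of terms concludes. *)

Lemma seq_has_maximal (d : Order.disp_t) (P : porderType d) (x : P) (s : seq P) :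
  exists2 p, p \in x :: s & forall q, q \in x :: s -> ~~ (p < q)%O.
Proof.
elim: s x => [|y s IHs] x.
  by exists x; rewrite ?mem_head // => q; rewrite inE => /eqP ->; rewrite ltxx.
have [m m_in m_max] := IHs y.
have [lt_mx|nlt_mx] := boolP (m < x)%O; last first.
  by exists m => [|q]; rewrite inE ?m_in ?orbT // => /predU1P[->|/m_max].
exists x; first exact: mem_head.
move=> q; rewrite inE => /predU1P[->|/m_max]; first by rewrite ltxx.
(* Anything above [x] would also be above [m]. *)
by apply: contra => /(lt_trans lt_mx).
Qed.

Lemma almost_gradation_sub (R : pzRingType) (M : lmodType R)
    (d : Order.disp_t) (P : porderType d) (F C : P -> submodClosed M) :
  almost_gradation F C -> forall p, {subset C p <= F p}.
Proof.
move=> gradC p x Cx; apply/(proj1 (gradC p)); exists 0, x.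
by rewrite add0r; split=> //; exact: rpred0.
Qed.

(** The inductive step: maximality of [p] is what makes distributivity
    applicable to [c p], seen as minus the sum of the other terms. *)
Lemma maximal_term_eq0 (R : pzRingType) (M : lmodType R)
    (d : Order.disp_t) (P : porderType d) (F C : P -> submodClosed M)
    (Q : {fset P}) (c : P -> M) (p : P) :
  distributive_filtration F -> almost_gradation F C ->
  {in Q, forall q, c q \in C q} -> \sum_(q <- Q) c q = 0 ->
  p \in Q -> (forall q, q \in Q -> ~~ (p < q)%O) -> c p = 0.
Proof.
move=> distrF gradC Cc sum0 pQ p_max.
have CF := almost_gradation_sub gradC.
apply: (proj2 (gradC p)) (Cc _ pQ).
apply: (distrF Q) => //; first exact/CF/Cc.
apply/sumsubP; exists (Q `\ p)%fset, (fun q => - c q); split=> // [q|].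
  by case/fsetD1P=> _ qQ; rewrite -scaleN1r rpredZ //; exact/CF/Cc.
by move/eqP: sum0; rewrite (big_fsetD1 p pQ) /= sumrN addr_eq0 => /eqP.
Qed.

Theorem proposition6p1 (R : pzRingType) (M : lmodType R)
    (d : Order.disp_t) (P : porderType d) (F : P -> submodClosed M) :
  poset_filtration F -> distributive_filtration F ->
  forall C : P -> submodClosed M, almost_gradation F C -> independent C.
Proof.
move=> _ distrF C gradC Q c.
have [n] := ubnP #|` Q|%fset; elim: n Q => // n IHn Q.
rewrite ltnS => leQn Cc sum0 q qQ.
have [p pQ p_max] : exists2 p, p \in Q & forall r, r \in Q -> ~~ (p < r)%O.
  have [p p_in p_max] := seq_has_maximal q Q.
  exists p => [|r rQ]; last by apply: p_max; rewrite inE rQ orbT.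
  by move: p_in; rewrite inE => /predU1P[->|].
have cp0 := maximal_term_eq0 distrF gradC Cc sum0 pQ p_max.
have [->//|neq_qp] := eqVneq q p.
apply: (IHn (Q `\ p)%fset); last by rewrite !inE neq_qp.
- by move: leQn; rewrite (cardfsD1 p Q) pQ.
- by move=> r /fsetD1P[_ /Cc].
- by move: sum0; rewrite (big_fsetD1 p pQ) /= cp0 add0r.
Qed.
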